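(* (a) For all $f\in G^+$, $\beta(\mu(f))=\eta^+(\gamma(f))$, and for all $f\in G^-$, $\beta(\mu(f))=\eta^-(\gamma(\rho(f)))$. (b) The maps $\mu|_{G^+}\colon G^+\to Z$, $\mu|_{G^-}\colon G^-\to Z$, $\eta^+\colon S_1\to S_2$, $\eta^-\colon S_1\to S_2$ are injections, $\mathrm{sb}\colon S_2\to B_1$ is a bijection, and the maps $\gamma\colon G^+\to S_1$, $\gamma\circ\rho\colon G^-\to S_1$, $\beta\colon Z\to S_2$ are surjections. (c) $\mu(G^+)=\beta^{-1}(\eta^+(S_1))$ and $\mu(G^-)=\beta^{-1}(\eta^-(S_1))$. (d) The map $\tau$ defined on $S_2$ by $\tau((q_1,\dots,q_l))=(A,B,C)$ with $$A=[q_1-1,q_2,\dots,q_l],\quad C=[q_1,\dots,q_{l-1},q_l-1],\quad B=[q_1,\dots,q_l]+[q_1-1,q_2,\dots,q_{l-1},q_l-1]$$ is a section of $\beta\colon Z\to S_2$. (e) The map $\xi$ defined on $S_1$ by $\xi((q_1,\dots,q_l))=(A,B,C)$ with $$A=[q_2,\dots,q_l],\quad B=[q_1,q_2,\dots,q_l]-[q_2,\dots,q_{l-1}],\quad C=-[q_1,\dots,q_{l-1}]$$ is a section of $\gamma\colon G^+\to S_1$. The image of $\xi$ is the set of forms in $G^+$ with discriminant of the form $k^2\pm4$ ($k$ an integer), and the form $\xi((q_1,\dots,q_l))$ has discriminant $$\left([q_1,\dots,q_l]+[q_2,\dots,q_{l-1}]\right)^2+(-1)^{l+1}\cdot4.$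$
   Context: A form $(A,B,C)$ means $Ax^2+Bxy+Cy^2$ with $A,B,C\in\mathbb{Z}$; its discriminant is $\Delta=B^2-4AC$. All forms are indefinite: $\Delta$ is positive and not a square. A form is G-reduced if $AC<0$ and $B>|A+C|$, and Z-reduced if $A,B,C>0$ and $B>A+C$. $G$ and $Z$ are the sets of G-reduced and Z-reduced forms; $G^+=\{(A,B,C)\in G: A>0\}$, $G^-=\{(A,B,C)\in G: A<0\}$. $S_1$ is the set of nonempty finite sequences of positive integers, $S_2\subset S_1$ those of length $\ge2$, and $B_1$ the set of binary strings with at least one $1$. Fundamental solution: for a positive nonsquare discriminant $\Delta$, the fundamental solution of $|t^2-\Delta u^2|=4$ is the solution $(t,u)$ in positive integers with $u$ minimal (for $\Delta=5$, where $(1,1)$ and $(3,1)$ both have $u=1$, it is $(1,1)$). Map $\gamma\colon G^+\to S_1$ (Dirichlet): for $f=(A,B,C)\in G^+$ with fundamental solution $(t,u)$, set $z=\frac{t+Bu}{2}$ (an integer) and let $\gamma(f)$ be the sequence of partial quotients of the finite regular continued fraction expansion (positive integer partial quotients) of $\frac{z}{Au}$ whose length is odd if $t^2-\Delta u^2=-4$ and even otherwise. Map $\beta\colon Z\to S_2$: for $f=(A,B,C)\in Z$ with fundamental solution $(t,u)$, set $z=\frac{t+Bu}{2}$ (an integer) and let $\beta(f)$ be the sequence of partial quotients of the finite regular continued fraction expansion of $\frac{z}{z-Au}$ whose length is even if $t^2-\Delta u^2=-4$ and odd otherwise. (Its length is always at least $2$.) Map $\mu\colon G\to Z$: $\mu((A,B,C))=(A,2A+B,A+B+C)$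 if $A>0$, and $\mu((A,B,C))=(A+B+C,B+2C,C)$ if $C>0$. Map $\rho\colon G\to G$: $\rho((A,B,C))=(-A,B,-C)$; it exchanges $G^+$ and $G^-$. Maps $\eta^+,\eta^-\colon S_1\to S_2$: $\eta^+$ prepends a $1$, $\eta^-$ appends a $1$. Map $\mathrm{sb}\colon S_2\to B_1$: $\mathrm{sb}((q_1,\dots,q_l))=0^{q_1-1}1\,0^{q_2-1}1\cdots1\,0^{q_l-1}$. Continuants: $[q_1,\dots,q_l]$ is the numerator, in lowest terms, of the regular continued fraction with partial quotients $q_1,\dots,q_l$; equivalently it satisfies $[q_1,\dots,q_l]=q_1[q_2,\dots,q_l]+[q_3,\dots,q_l]$ with the conventions that the empty continuant $[q_s,\dots,q_{s-1}]$ equals $1$ and $[q_s,\dots,q_{s-2}]$ equals $0$. End entries equal to $0$ are allowed: $[0]=0$, $[0,q_2,\dots,q_l]=[q_3,\dots,q_l]$ and $[q_1,\dots,q_{l-1},0]=[q_1,\dots,q_{l-2}]$ for $l\ge2$. In particular $[0,0]=1$.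
   Formalization: Surjectivity of γ, γ∘ρ and the section property of ξ are stated away from (1,1), those of β and τ away from (1,1,1): ξ((1))=ξ((1,1))=(1,1,-1) and τ((1,1))=τ((1,1,1))=(1,3,1) of discriminant 5, and γ, γ∘ρ never take the value (1,1), nor β the value (1,1,1). *)

(* Defs.v *)
From HB Require Import structures.
From mathcomp Require Export all_boot all_order all_algebra.
From mathcomp Require Export boolp classical_sets functions.
From mathcomp Require Import zify ring lra.

Set Implicit Arguments.
Unset Strict Implicit.
Unset Printing Implicit Defensive.
Import Order.TTheory GRing.Theory Num.Theory.
Local Open Scope classical_set_scope.
Local Open Scope ring_scope.

Definition form : Type := (int * int * int)%type.

Definition disc (f : form) : int := let: (A, B, C) := f in B ^+ 2 - 4 * A * C.

Definition indefinite (f : form) : Prop :=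
  0 < disc f /\ ~ (exists k : int, disc f = k ^+ 2).

Definition Gforms : set form :=
  [set f | let: (A, B, C) := f in
     [/\ indefinite f, A * C < 0 & `|A + C| < B]].

Definition Gpos : set form := [set f | Gforms f /\ 0 < f.1.1].
Definition Gneg : set form := [set f | Gforms f /\ f.1.1 < 0].

Definition Zforms : set form :=
  [set f | let: (A, B, C) := f in
     [/\ indefinite f, [/\ 0 < A, 0 < B & 0 < C] & A + C < B]].

Definition S1 : set (seq nat) :=
  [set q | q <> [::] /\ all (fun a => 0 < a)%N q].
Definition S2 : set (seq nat) := [set q | S1 q /\ (2 <= size q)%N].
Definition B1 : set (seq bool) := [set b | has id b].

Definition pell4 (D t u : int) : Prop :=
  [/\ 0 < t, 0 < u & `|t ^+ 2 - D * u ^+ 2| = 4].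

(* For D = 5 both (1, 1) and (3, 1) have u minimal. *)
Definition fundamental (D : int) (tu : int * int) : Prop :=
  [/\ pell4 D tu.1 tu.2,
      forall t' u' : int, pell4 D t' u' -> tu.2 <= u'
    & D = 5 -> tu.1 = 1].

Definition fund_sol (D : int) : int * int :=
  xget (0, 0) [set tu | fundamental D tu].

(* Value of the finite regular continued fraction with partial quotients q;
   since 0^-1 = 0 in rat, [:: a] has value a. *)
Fixpoint cfval (q : seq nat) : rat :=
  if q is a :: s then a%:R + (cfval s)^-1 else 0.

(* The partial quotients of the expansion of x whose length is odd if b is true
   and even if b is false. The default [::] is not in S1. *)
Definition cfexp (x : rat) (b : bool) : seq nat :=
  xget [::] [set q | [/\ S1 q, cfval q = x & odd (size q) = b]].

Definition gamma (f : form) : seq nat :=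
  let: (A, B, C) := f in
  let: (t, u) := fund_sol (disc f) in
  let z : rat := (t + B * u)%:~R / 2 in
  cfexp (z / (A * u)%:~R) (t ^+ 2 - disc f * u ^+ 2 == - 4).

Definition beta (f : form) : seq nat :=
  let: (A, B, C) := f in
  let: (t, u) := fund_sol (disc f) in
  let z : rat := (t + B * u)%:~R / 2 in
  cfexp (z / (z - (A * u)%:~R)) (t ^+ 2 - disc f * u ^+ 2 != - 4).

(* On G-reduced forms exactly one of 0 < A and 0 < C holds. *)
Definition mu (f : form) : form :=
  let: (A, B, C) := f in
  if 0 < A then (A, 2 * A + B, A + B + C) else (A + B + C, B + 2 * C, C).

Definition rho (f : form) : form := let: (A, B, C) := f in (- A, B, - C).

Definition etapos (q : seq nat) : seq nat := 1%N :: q.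
Definition etaneg (q : seq nat) : seq nat := rcons q 1%N.

Fixpoint sb (q : seq nat) : seq bool :=
  match q with
  | [::] => [::]
  | [:: a] => nseq a.-1 false
  | a :: s => nseq a.-1 false ++ true :: sb s
  end.

Fixpoint continuant (q : seq nat) : nat :=
  match q with
  | [::] => 1
  | [:: a] => a
  | a :: ((_ :: s') as s) => a * continuant s + continuant s'
  end.

(* [q_i, ..., q_j] with 1-based indices: it is 1 if j = i - 1 and 0 if
   j = i - 2. *)
Definition cont (q : seq nat) (i j : nat) : int :=
  if (j.+1 < i)%N then 0 else (continuant (drop i.-1 (take j q)))%:Z.

(* q with its entry of 0-based index i decreased by 1 *)
Definition decr (i : nat) (q : seq nat) : seq nat :=
  set_nth 0%N q i (nth 0%N q i).-1.

Definition tau (q : seq nat) : form :=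
  let l := size q in
  ((continuant (decr 0 q))%:Z,
   (continuant q)%:Z + (continuant (decr 0 (decr l.-1 q)))%:Z,
   (continuant (decr l.-1 q))%:Z).

Definition xi (q : seq nat) : form :=
  let l := size q in
  (cont q 2 l, cont q 1 l - cont q 2 l.-1, - cont q 1 l.-1).

(* The only form of discriminant 5 in Gpos is (1, 1, -1) = xi [:: 1] =
   xi [:: 1; 1], and the only one in Zforms is (1, 3, 1) = tau [:: 1; 1] =
   tau [:: 1; 1; 1]. As the fundamental solution is then (1, 1), these forms are
   sent to [:: 1] by gamma and to [:: 1; 1] by beta, so that gamma misses
   gamma_gap and beta misses beta_gap. Surjectivity of gamma, gamma \o rho and
   beta, and the sections xi and tau, are therefore stated away from these two
   sequences. *)
Definition gamma_gap : seq nat := [:: 1; 1]%N.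
Definition beta_gap : seq nat := [:: 1; 1; 1]%N.

Lemma cfexpP (x : rat) (b : bool) (q : seq nat) :
  cfexp x b = q -> q <> [::] -> cfval q = x /\ odd (size q) = b.
Proof. by rewrite /cfexp; case: xgetP => [y _ [_ ? ?] <- //|_ <-]. Qed.

Lemma fund_solP (D t u : int) :
  fund_sol D = (t, u) -> u != 0 -> fundamental D (t, u).
Proof.
by rewrite /fund_sol; case: xgetP => [y _ Hy <- //|_ [_ <-]]; rewrite eqxx.
Qed.

Lemma gamma_gap_not_value (f : form) : Gpos f -> gamma f <> gamma_gap.
Proof.
case: f => [[A B] C] [[[_ _] _ hB] /= A0]; rewrite /gamma.
case E: (fund_sol _) => [t u] /cfexpP [] // hv /esym/negbT/eqP hn.
have e2 : cfval gamma_gap = 2 by apply/eqP.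
move: hv; rewrite {}e2 => hv.
have u0 : u != 0.
  by apply/eqP => u0; move: hv; rewrite u0 !mulr0 mulr0z invr0 mulr0.
have [/= [t0 up h4] _ h5] := fund_solP E u0.
have Au0 : ((A * u)%:~R : rat) != 0 by rewrite intr_eq0 mulf_neq0 // gt_eqF.
have hz : t + B * u = 4 * (A * u).
  have h : ((t + B * u)%:~R / 2 : rat) = 2 * (A * u)%:~R by rewrite [in RHS]hv divfK.
  apply: (@intr_inj rat).
  rewrite (_ : (4 * (A * u))%:~R = 4 * (A * u)%:~R :> rat); last by rewrite intrM.
  move: h; move: ((t + B * u)%:~R : rat) ((A * u)%:~R : rat) => x y h; lra.
have h4' : t ^+ 2 - (B ^+ 2 - 4 * A * C) * u ^+ 2 = 4 by move: hn h4; rewrite /disc; lia.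
have hp : A * u * (t - B * u + C * u) = 1.
  have : (t + B * u) * (t - B * u) + 4 * (A * u) * (C * u) = 4.
    by rewrite -[RHS]h4'; ring.
  by rewrite hz => h; nia.
have Au1 : A * u = 1.
  have : 0 < A * u by rewrite mulr_gt0.
  move: (A * u) (t - B * u + C * u) hp => a w hw ha.
  have w0 : 0 < w by nia.
  nia.
have A1 : A = 1 by clear hp hz h4 h4' hn h5 hv E Au0; nia.
have u1 : u = 1 by rewrite A1 mul1r in Au1.
subst A u.
have C1 : C = -1 by nia.
subst C.
have := h5; rewrite /disc; nia.
Qed.

Lemma beta_gap_not_value (f : form) : Zforms f -> beta f <> beta_gap.
Proof.
case: f => [[A B] C] [[_ _] [A0 B0 C0] hB]; rewrite /beta.
case E: (fund_sol _) => [t u] /cfexpP [] // hv /esym /eqP hn.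
have e2 : cfval beta_gap = 3 / 2.
  by apply/eqP.
move: hv; rewrite {}e2 => hv.
have u0 : u != 0.
  apply/eqP => u0; move: E; rewrite u0 => E; move: hv; rewrite u0 !mulr0 addr0 mulr0z subr0.
  by have [->|n0] := eqVneq (t%:~R / 2 : rat) 0; [rewrite mul0r | rewrite divff].
have [/= [t0 up h4] _ h5] := fund_solP E u0.
have hz : t + B * u = 6 * (A * u).
  have d0 : ((t + B * u)%:~R / 2 - (A * u)%:~R : rat) != 0.
    by apply/eqP => d0; move: hv; rewrite d0 invr0 mulr0.
  have h : ((t + B * u)%:~R / 2 : rat)
           = 3 / 2 * ((t + B * u)%:~R / 2 - (A * u)%:~R).
    by rewrite hv divfK.
  apply: (@intr_inj rat).
  rewrite (_ : (6 * (A * u))%:~R = 6 * (A * u)%:~R :> rat); last by rewrite intrM.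
  move: h; move: ((t + B * u)%:~R : rat) ((A * u)%:~R : rat) => x y h; lra.
have h4' : t ^+ 2 - (B ^+ 2 - 4 * A * C) * u ^+ 2 = 4 by move: hn h4; rewrite /disc /=; lia.
have hp : A * u * (3 * (t - B * u) + 2 * (C * u)) = 2.
  have : (t + B * u) * (t - B * u) + 4 * (A * u) * (C * u) = 4.
    by rewrite -[RHS]h4'; ring.
  by rewrite hz => h; nia.
have Au12 : A * u = 1 \/ A * u = 2.
  have : 0 < A * u by rewrite mulr_gt0.
  move: (A * u) (3 * (t - B * u) + 2 * (C * u)) hp => a w hw ha.
  have w0 : 0 < w by nia.
  have : a <= 2 by nia.
  lia.
have [[A1 u1]|[[A1 u2]|[A2 u1]]] :
    (A = 1 /\ u = 1) \/ (A = 1 /\ u = 2) \/ (A = 2 /\ u = 1).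
- by clear hp hz h4 h4' hn h5 hv E; nia.
- subst A u; have C1 : C = 1 by lia.
  subst C; have B3 : B = 3 by lia.
  by subst B; have /= := h5 erefl; lia.
- by subst A u; lia.
- by subst A u; lia.
Qed.

(* Main.v *)
Require Import Defs.
From mathcomp Require Import zify ring lra.
Set Implicit Arguments.
Unset Strict Implicit.
Unset Printing Implicit Defensive.
Import Order.TTheory GRing.Theory Num.Theory.
Local Open Scope classical_set_scope.
Local Open Scope ring_scope.

(** Both expansions are factorizations of an integer matrix. Quadruples
    (a, b, c, d) stand for the matrix with rows (a, b) and (c, d).

    The product of the matrices with rows (q_i, 1) and (1, 0) has as its entries
    the four continuants [q_1..q_l], [q_1..q_(l-1)], [q_2..q_l],
    [q_2..q_(l-1)], its determinant is (-1)^l, and the quotient of its first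
    column is the value of the continued fraction. The matrices so obtained are
    exactly those with determinant 1 or -1 whose entries do not increase along
    rows and columns and are positive, except that the last one may vanish; each
    of them comes from a unique sequence ([cfmat_shaped], [cf_shaped_cfmat], [cfmat_inj]).

    For a form (A, B, C) and a solution (t, u) of |t^2 - D u^2| = 4, put
    z = (t + B u) / 2. The matrix with rows (z, - C u) and (A u, z - B u) has
    determinant (t^2 - D u^2) / 4, and it has the shape above when the form is
    G-reduced with A > 0; so gamma f is the sequence of this matrix
    ([automat_shaped], [gammaP]). Likewise beta f is the sequence of the matrix
    with rows (z, z - C u) and (z - A u, (B - A - C) u) when the form is
    Z-reduced ([zmat_shaped], [betaP]).

    All claims become matrix identities. Applying mu multiplies the first matrix
    by the matrix of the one-term sequence 1, on the left when A > 0 and on the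
    right (after rho) when A < 0, which is prepending or appending a 1.
    Conversely the shape of a matrix forces its form to be G-reduced
    ([automat_Gpos]); this identifies the images of mu. The sections xi and tau
    read a form off a matrix by taking u = 1. Their discriminants differ from a
    square by 4, so the forms are indefinite, and u = 1 makes the solution
    fundamental unless the discriminant is 5, where the two gaps arise.

    That gamma and beta are defined everywhere needs the solvability of Pell's
    equation, which is proved by a Stern-Brocot descent ([pell_solvable]). *)

(** * Continued fractions as matrices *)

Fixpoint cfmat (q : seq nat) : int * int * int * int :=
  if q is x :: s then
    let: (a, b, c, d) := cfmat s in (x%:Z * a + c, x%:Z * b + d, a, b)
  else (1, 0, 0, 1).

Definition det2 (m : int * int * int * int) : int :=
  let: (a, b, c, d) := m in a * d - b * c.

Definition cf_shaped (m : int * int * int * int) : Prop :=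
  let: (a, b, c, d) := m in
  [/\ [/\ 0 < b, 0 < c & 0 <= d], [/\ d <= b, d <= c, b <= a & c <= a]
    & a * d - b * c = 1 \/ a * d - b * c = - 1].

Lemma det_cfmat q : det2 (cfmat q) = (-1) ^+ size q.
Proof.
elim: q => [|x s] /=; first by lia.
by case: (cfmat s) => [[[a b] c] d] /= IH; rewrite exprS -IH; ring.
Qed.

Lemma odd_size_cfmat q : odd (size q) = (det2 (cfmat q) == -1).
Proof. by rewrite det_cfmat -signr_odd; case: odd. Qed.

Lemma S1_nil : ~ S1 [::].
Proof. by case. Qed.

Lemma S1_cons x s : S1 (x :: s) <-> (0 < x)%N /\ (s = [::] \/ S1 s).
Proof.
rewrite /S1 /=; split=> [[_ /andP[x0 hs]]|[x0 hs]].
  by split=> //; case: s hs => [|y s] hs; [left|right].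
by split=> //; rewrite x0 /=; case: hs => [->|[]].
Qed.

Lemma cfmat_shaped q : S1 q -> cf_shaped (cfmat q).
Proof.
elim: q => [/S1_nil//|x s IH] /S1_cons [x0 [->|/IH]] /=.
  by split; [split|split|right]; lia.
case: (cfmat s) => [[[a b] c] d] [[b0 c0 d0] [h1 h2 h3 h4] h5].
split; [split; nia|split; nia|].
have e : (x%:Z * a + c) * b - (x%:Z * b + d) * a = - (a * d - b * c) by ring.
by rewrite e; case: h5 => ->; [right|left]; rewrite ?opprK.
Qed.

Lemma cfval_cfmat q : S1 q ->
  let: (a, b, c, d) := cfmat q in cfval q = a%:~R / c%:~R.
Proof.
elim: q => [/S1_nil//|x s IH] /S1_cons [x0 [->|hs]] /=.
  by rewrite invr0 mulr1 !addr0 divr1.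
have := IH hs; have := cfmat_shaped hs.
case: (cfmat s) => [[[a b] c] d] [[b0 c0 d0] [h1 h2 h3 h4] h5] ->.
have a0 : a%:~R != 0 :> rat by rewrite intr_eq0; lia.
by rewrite invf_div rmorphD rmorphM /= mulrDl mulfK.
Qed.

Lemma cfval_ge1 q : S1 q -> 1 <= cfval q ?= iff (q == [:: 1%N]).
Proof.
elim: q => [/S1_nil//|x s IH] /S1_cons [x0 [->|hs]] /=.
  rewrite invr0 addr0; split; first by rewrite ler1n.
  by rewrite eqseq_cons andbT -[1]/(1%:R) eqr_nat eq_sym.
have h1 := (IH hs).1; have hx : 1 <= x%:R :> rat by rewrite ler1n.
have hi : 0 < (cfval s)^-1 by rewrite invr_gt0; lra.
split; first by lra.
have -> : (1 == x%:R + (cfval s)^-1 :> rat) = false by apply/eqP; lra.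
by case: s hs {IH h1 hi} => [/S1_nil//|y s _]; rewrite eqseq_cons andbF.
Qed.

(** A value has at most two expansions, one ending in q and one in q - 1, 1,
    and their lengths have opposite parities. So when first quotients are peeled
    off, they agree unless one remaining sequence is 1 and the other is empty,
    and then the parities differ. *)
Lemma cfval_inj q q' : S1 q -> S1 q' -> cfval q = cfval q' ->
  odd (size q) = odd (size q') -> q = q'.
Proof.
have frac s : S1 s -> 0 < (cfval s)^-1 <= 1 /\ ((cfval s)^-1 = 1 -> s = [:: 1%N]).
  move=> /cfval_ge1 [h1 h2]; split; first by rewrite invr_gt0 invf_le1; lra.
  by move=> /(congr1 GRing.inv); rewrite invrK invr1 => h; apply/eqP; rewrite -h2 h.
elim: q q' => [|x s IH] [|x' s'] //; [by move=> /S1_nil|by move=> _ /S1_nil|].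
move=> /S1_cons [x0 hs] /S1_cons [x'0 hs'] /= hv hp.
have {hp} hp : odd (size s) = odd (size s') by case: odd hp; case: odd.
have int_gap (i j : nat) (e e' : rat) : i%:R + e = j%:R + e' ->
    0 <= e <= 1 -> 0 <= e' <= 1 -> [\/ i = j, e = 1 /\ e' = 0 | e' = 1 /\ e = 0].
  move=> h he he'; have [lij|lji|->] := ltngtP i j; last by constructor 1.
    have : i%:R + 1 <= j%:R :> rat by rewrite natr1 ler_nat.
    by constructor 2; lra.
  have : j%:R + 1 <= i%:R :> rat by rewrite natr1 ler_nat.
  by constructor 3; lra.
have bnd r : r = [::] \/ S1 r -> 0 <= (cfval r)^-1 <= 1.
  by case=> [->|/frac [h _]]; rewrite ?invr0; lra.
have zero r : r = [::] \/ S1 r -> (cfval r)^-1 = 0 -> r = [::].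
  by case=> // /frac [h _] h0; move: h; rewrite h0 ltxx.
have one r : r = [::] \/ S1 r -> (cfval r)^-1 = 1 -> r = [:: 1%N].
  by case=> [->|/frac [_]//]; rewrite invr0.
case: (int_gap _ _ _ _ hv (bnd _ hs) (bnd _ hs')) =>
  [e|[/(one _ hs) e /(zero _ hs') e']|[/(one _ hs') e' /(zero _ hs) e]].
- subst x'; move: hv => /addrI hv; congr cons.
  case: hs hs' => [sE|hs] [s'E|hs'].
  + by rewrite sE s'E.
  + by rewrite sE [RHS]zero //; [right|rewrite -hv sE invr0].
  + by rewrite s'E [LHS]zero //; [right|rewrite hv s'E invr0].
  + by apply: IH => //; apply: invr_inj.
- by move: hp; rewrite e // e'.
- by move: hp; rewrite e // e'.
Qed.

Lemma cfmat_inj q q' : S1 q -> S1 q' -> cfmat q = cfmat q' -> q = q'.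
Proof.
move=> hq hq' h; apply: cfval_inj => //; last by rewrite !odd_size_cfmat h.
have := cfval_cfmat hq; have := cfval_cfmat hq'; rewrite h.
by case: (cfmat q') => [[[a b] c] d] -> ->.
Qed.

(** Euclidean division of the first column by its lower entry: if a = x c + r,
    subtracting x times the second row from the first and exchanging the rows
    gives a matrix of the same shape with lower entry r < c. Unimodularity is what keeps the second
    column ordered as well. *)
Lemma cf_shaped_cfmat m : cf_shaped m -> exists2 q, S1 q & cfmat q = m.
Proof.
case: m => [[[a b] c] d] hm.
have [n] := ubnP `|c|%N.
elim: n a b c d hm => // n IH a b c d hm hn.
have [[b0 c0 d0] [h1 h2 h3 h4] h5] := hm.
have [c1|c2] := leP c 1.
  have {c1} c1 : c = 1 by lia.
  subst c; have [d1|d1] : d = 0 \/ d = 1 by lia.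
    subst d; exists [:: `|a|%N]; first by apply/S1_cons; split; [lia|left].
    by rewrite /=; congr (_, _, _, _); lia.
  subst d; exists [:: `|b|%N; 1%N].
    by apply/S1_cons; split; [lia|right; apply/S1_cons; split=> //; left].
  by rewrite /=; congr (_, _, _, _); lia.
have bc : c <= b * c by nia.
have d1 : 0 < d.
  by rewrite lt_neqAle d0 andbT; apply/eqP => e; move: h5; rewrite -e mulr0; lia.
(* since c >= 2, it divides neither 1 nor -1 *)
have unit_c k : k * c = a * d - b * c -> False.
  have [->|[|]] : k = 0 \/ k <= -1 \/ 1 <= k by lia.
  - lia.
  - nia.
  - nia.
have dc : d < c.
  rewrite lt_neqAle h2 andbT; apply/eqP => e.
  by apply: (unit_c (a - b)); rewrite e; ring.
set x := (a %/ c)%Z; set r := (a %% c)%Z.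
have ea : a = x * c + r by exact: divz_eq.
have r0 : 0 <= r by rewrite modz_ge0 //; lia.
have rc : r < c by rewrite ltz_pmod.
have x1 : 0 < x.
  rewrite ltNge; apply/negP => x0; have : x * c <= 0 by nia.
  by lia.
have {r0} r1 : 0 < r.
  rewrite lt_neqAle r0 andbT; apply/eqP => e.
  by apply: (unit_c (x * d - b)); rewrite ea -e; ring.
pose s := b - x * d.
have hs : c * s = d * r - (a * d - b * c) by rewrite /s ea; ring.
have [] := IH c d r s.
- split; [split; nia|split; nia|].
  have -> : c * s - d * r = - (a * d - b * c) by rewrite hs; ring.
  by lia.
- by lia.
move=> q hq qE; exists (`|x|%N :: q); first by apply/S1_cons; split; [lia|right].
by rewrite /= qE; congr (_, _, _, _); rewrite gez0_abs ?(ltW x1) // /s ?ea; ring.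
Qed.

Lemma cfexp_eq q x b : S1 q -> cfval q = x -> odd (size q) = b -> cfexp x b = q.
Proof.
move=> hq hx hb; rewrite /cfexp; case: xgetP => [y _ [hy hyx hyb]|/(_ q)[]//].
by apply: cfval_inj => //; [rewrite hyx|rewrite hyb].
Qed.

(** * Solvability of Pell's equation *)

Lemma nonsquare_ratio (D x y : int) :
  ~ (exists k : int, D = k ^+ 2) -> y != 0 -> x ^+ 2 != D * y ^+ 2.
Proof.
move=> hD y0; apply/eqP => h; apply: hD.
have /dvdzP[k kE] : (y %| x)%Z.
  rewrite dvdzE -(@dvdn_pexp2r _ _ 2) // -!abszX -dvdzE h.
  exact: dvdz_mull.
exists k; have y2 : y ^+ 2 != 0 by rewrite expf_neq0.
by apply: (mulIf y2); rewrite -h kE exprMn.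
Qed.

(** One step of the search for sqrt D in the Stern-Brocot tree: the fractions
    p/r > sqrt D > q/s are the current endpoints (r = 0 being the fraction
    1/0), and their mediant replaces one of them. *)
Definition sb_step (D : int) (m : int * int * int * int) :=
  let: (p, q, r, s) := m in
  if (p + q) ^+ 2 < D * (r + s) ^+ 2 then (p, p + q, r, r + s)
  else (p + q, q, r + s, s).

Definition straddles (D : int) (m : int * int * int * int) : Prop :=
  let: (p, q, r, s) := m in
  [/\ [/\ 0 < p, 0 <= q, 0 <= r & 0 < s], p * s - q * r = 1,
      D * r ^+ 2 < p ^+ 2 & q ^+ 2 < D * s ^+ 2].

Lemma pigeonhole_seq (T : eqType) (g : nat -> T) (s : seq T) :
  (forall n, g n \in s) -> exists i j, (i < j)%N /\ g i = g j.
Proof.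
move=> hg; have : ~~ uniq (mkseq g (size s).+1).
  apply/negP => /(@uniq_leq_size _ _ s); rewrite size_mkseq ltnn.
  by move=> h; apply: notF; apply: h => x /mapP[n _ ->].
case/(uniqPn (g 0%N)) => i [j []]; rewrite size_mkseq => lij lj.
by rewrite !nth_mkseq ?(ltn_trans lij) // => e; exists i, j.
Qed.

(** Along the search, the columns of the matrix are a basis of Z^2 in which
    x^2 - D y^2 becomes an indefinite form with outer coefficients of opposite
    signs and determinant - D. Such forms are finitely many, so some form
    occurs twice. The change of basis between the two occurrences then
    preserves x^2 - D y^2, and the image of (1, 0) under it is a solution up to
    signs. It has y <> 0 because the entries of the matrices grow. *)
Lemma pell_solvable (D : int) : 0 < D -> ~ (exists k : int, D = k ^+ 2) ->
  exists x y : int, [/\ 0 < x, 0 < y & x ^+ 2 - D * y ^+ 2 = 1].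
Proof.
move=> D0 hD; pose st n := iter n (sb_step D) (1, 0, 0, 1).
have inv n : straddles D (st n).
  elim: n => [|n]; first by split=> //; [rewrite mulr0|rewrite expr1n mulr1].
  rewrite /st iterS -/(st n); case: (st n) => [[[p q] r] s] [[p0 q0 r0 s0] h1 h2 h3] /=.
  have hne : (p + q) ^+ 2 != D * (r + s) ^+ 2 by apply: nonsquare_ratio => //; lia.
  case: ltP => hlt; split=> //; try by split; lia.
  - by rewrite -h1; ring.
  - by rewrite -h1; ring.
  - by rewrite lt_neqAle hlt eq_sym hne.
pose total (m : int * int * int * int) : int := let: (p, q, r, s) := m in p + q + r + s.
have grow i j : (i < j)%N -> total (st i) < total (st j).
  elim: j => // j IH; rewrite ltnS leq_eqVlt => /orP[/eqP ->|/IH h].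
    have := inv j; rewrite /st iterS -/(st j).
    by case: (st j) => [[[p q] r] s] [[p0 q0 r0 s0] _ _ _] /=;
      case: ifP => _; rewrite /total; lia.
  apply: (lt_trans h).
  have := inv j; rewrite /st iterS -/(st j).
  by case: (st j) => [[[p q] r] s] [[p0 q0 r0 s0] _ _ _] /=;
      case: ifP => _; rewrite /total; lia.
(* the two coefficients that determine the form, its determinant being - D *)
pose key (m : int * int * int * int) : int * int := let: (p, q, r, s) := m in
  (p ^+ 2 - D * r ^+ 2, p * q - D * (r * s)).
pose N := `|D|%N.
pose box := [seq (i%:Z, j%:Z - N%:Z) | i <- iota 0 N.+1, j <- iota 0 (N + N).+1].
have [] := @pigeonhole_seq _ (key \o st) box.
  move=> n /=; have := inv n; case: (st n) => [[[p q] r] s] [[p0 q0 r0 s0] h1 h2 h3] /=.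
  set A := (_ - _); set H := (_ - _); pose C := q ^+ 2 - D * s ^+ 2.
  have A0 : 0 < A by rewrite subr_gt0.
  have C0 : C < 0 by rewrite subr_lt0.
  have hd : H ^+ 2 - A * C = D.
    by rewrite -[RHS]mulr1 -[1](expr1n _ 2) -h1 /H /A /C; ring.
  have AC0 : A * C <= - A by rewrite -mulrN1 ler_pM2l //; lia.
  have H2 : 0 <= H ^+ 2 by exact: sqr_ge0.
  have AD : A <= D by lia.
  have HD : H ^+ 2 <= D by lia.
  have {}HD : - D <= H <= D by move: HD; rewrite expr2; clear -D0; nia.
  apply/allpairsP; exists (`|A|%N, `|(H + D)%R|%N).
  by rewrite !mem_iota /N; split; rewrite /=; [lia|lia|congr (_, _); lia].
move=> i [j [lij]] /=; have := grow _ _ lij; have := inv i; have := inv j.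
case: (st j) => [[[p' q'] r'] s'] [[p'0 q'0 r'0 s'0] h1' h2' h3'].
case: (st i) => [[[p q] r] s] [[p0 q0 r0 s0] h1 h2 h3] /= ht [eA eH].
have eC : q ^+ 2 - D * s ^+ 2 = q' ^+ 2 - D * s' ^+ 2.
  have A0 : p ^+ 2 - D * r ^+ 2 != 0 by rewrite gt_eqF // subr_gt0.
  apply: (mulfI A0); rewrite [in RHS]eA.
  have e (a b c d : int) : a * d - b * c = 1 ->
    (a ^+ 2 - D * c ^+ 2) * (b ^+ 2 - D * d ^+ 2) = (a * b - D * (c * d)) ^+ 2 - D.
    move=> h; transitivity ((a * b - D * (c * d)) ^+ 2 - D * (a * d - b * c) ^+ 2).
      by ring.
    by rewrite h expr1n mulr1.
  by rewrite !e // eH.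
(* (x, y) is the image of (1, 0) under the change of basis *)
pose x := p' * s - q' * r; pose y := r' * s - s' * r.
have hxy : x ^+ 2 - D * y ^+ 2 = 1.
  transitivity ((p' ^+ 2 - D * r' ^+ 2) * s ^+ 2
     - 2 * (p' * q' - D * (r' * s')) * (s * r) + (q' ^+ 2 - D * s' ^+ 2) * r ^+ 2).
    by rewrite /x /y; ring.
  rewrite -eA -eH -eC; transitivity ((p * s - q * r) ^+ 2); first by ring.
  by rewrite h1 expr1n.
have y0 : y != 0.
  apply/eqP => y0.
  (* then (r, s) and (r', s') are proportional primitive vectors, hence equal,
     and so are the bases, since they give the same form *)
  have ex : s = s' * x /\ r = r' * x.
    split; rewrite -[LHS]mulr1 -h1' /x.
      by rewrite -[RHS]subr0 -(mulr0 q') -y0 /y; ring.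
    by rewrite -[RHS]subr0 -(mulr0 p') -y0 /y; ring.
  have x1 : x = 1.
    have : x ^+ 2 == 1 by rewrite -hxy y0 expr0n /= mulr0 subr0.
    rewrite sqrf_eq1 => /orP[/eqP//|/eqP xN].
    by have [es _] := ex; move: es; rewrite xN; lia.
  have [es er] : s = s' /\ r = r' by move: ex; rewrite x1 !mulr1.
  have root_eq (a b : int) : 0 <= a -> 0 <= b -> a ^+ 2 = b ^+ 2 -> a = b.
    by move=> a0 b0 /eqP; rewrite eqrXn2 // => /eqP.
  have ep : p = p'.
    by apply: root_eq; [exact: ltW|exact: ltW|move: eA; rewrite er; lia].
  have eq : q = q' by apply: root_eq => //; move: eC; rewrite es; lia.
  by move: ht; rewrite /= es er ep eq ltxx.
exists `|x|, `|y|; split; last by rewrite !real_normK ?num_real.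
  by rewrite normr_gt0; apply/eqP => x0; move: hxy; rewrite x0; nia.
by rewrite normr_gt0.
Qed.

(** * Fundamental solutions *)

Lemma pell4_ex (D : int) : 0 < D -> ~ (exists k : int, D = k ^+ 2) ->
  exists t u, pell4 D t u.
Proof.
move=> D0 hD; have [x [y [x0 y0 h]]] := pell_solvable D0 hD.
exists (2 * x), (2 * y); split; [lia|lia|].
have -> : (2 * x) ^+ 2 - D * (2 * y) ^+ 2 = 4 * (x ^+ 2 - D * y ^+ 2) by ring.
by rewrite h.
Qed.

(** Two squares of positive integers differ by 8 only when they are 9 and 1,
    which forces D u^2 = 5. *)
Lemma pell4_eq_t (D t t' u : int) : D <> 5 -> pell4 D t u -> pell4 D t' u -> t = t'.
Proof.
move=> D5 [t0 u0 h] [t'0 _ h'].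
have : t ^+ 2 - t' ^+ 2 = 0 \/ t ^+ 2 - t' ^+ 2 = 8 \/ t' ^+ 2 - t ^+ 2 = 8 by lia.
have gap (a b : int) : 0 < a -> 0 < b -> a ^+ 2 - b ^+ 2 = 8 -> a = 3 /\ b = 1.
  move=> a0 b0; rewrite subr_sqr => e.
  have hab : b < a by nia.
  have [e1|[e1|e1]] : a - b = 1 \/ a - b = 2 \/ 3 <= a - b by lia.
  - by move: e; rewrite e1; lia.
  - by move: e; rewrite e1; lia.
  - by nia.
have no5 : D * u ^+ 2 = 5 -> False.
  move=> e; have [u1|u2] : u = 1 \/ 2 <= u by lia.
    by apply: D5; move: e; rewrite u1 expr1n mulr1.
  have D1 : 1 <= D by nia.
  have [D1'|D2] : D = 1 \/ 2 <= D by lia.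
    move: e; rewrite D1' mul1r => e.
    have [u3|u3] : u = 2 \/ 3 <= u by lia.
      by move: e; rewrite u3.
    by nia.
  by nia.
case=> [|[|]].
- by rewrite subr_sqr => /eqP; rewrite mulf_eq0 => /orP[/eqP|/eqP]; lia.
- by move=> /(gap _ _ t0 t'0)[e e']; case: no5; move: h h'; rewrite e e'; lia.
- by move=> /(gap _ _ t'0 t0)[e e']; case: no5; move: h h'; rewrite e e'; lia.
Qed.

Lemma fund_sol_fundamental (D : int) : 0 < D -> ~ (exists k : int, D = k ^+ 2) ->
  fundamental D (fund_sol D).
Proof.
move=> D0 hD; rewrite /fund_sol.
suff [tu htu] : exists tu, fundamental D tu.
  by apply: (@xgetPex _ (0, 0) [set tu | fundamental D tu]); exists tu.
have [D5|D5] := pselect (D = 5).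
  by exists (1, 1); split=> //= [|t' u' [_]]; [rewrite D5|lia].
have ex : exists n : nat, `[< exists t, pell4 D t n%:Z >].
  have [t [u h]] := pell4_ex D0 hD; exists `|u|%N; apply/asboolP; exists t.
  by rewrite gez0_abs //; case: h => _ /ltW.
case: (ex_minnP ex) => n /asboolP [t ht] hmin.
exists (t, n%:Z); split=> //= t' u' h'.
have u'0 : 0 < u' by case: h'.
have /hmin : `[< exists t, pell4 D t `|u'|%N%:Z >].
  by apply/asboolP; exists t'; rewrite gez0_abs // ltW.
by lia.
Qed.

(** Any solution with u = 1 has minimal u, and for D = 5 the convention selects
    t = 1. *)
Lemma fund_sol_unit (D t : int) : pell4 D t 1 -> (D = 5 -> t = 1) ->
  fund_sol D = (t, 1).
Proof.
move=> ht h5.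
have hf : fundamental D (t, 1) by split=> //= t' u' [_]; lia.
have : fundamental D (fund_sol D).
  exact: (@xgetPex _ (0, 0) [set tu | fundamental D tu] (ex_intro _ _ hf)).
case: (fund_sol D) => t' u' [/= h' hmin h5'].
have u'1 : u' = 1 by have := hmin _ _ ht; case: h' => _; lia.
subst u'; congr (_, _); have [D5|D5] := pselect (D = 5).
  by rewrite h5' ?h5.
exact: (pell4_eq_t D5 h' ht).
Qed.

(** * The matrices of a form *)

Definition half_trace (B t u : int) : int := ((t + B * u) %/ 2)%Z.

Lemma half_traceE (A B C t u : int) : pell4 (disc (A, B, C)) t u ->
  t + B * u = 2 * half_trace B t u.
Proof.
case=> _ _ /= h; rewrite /half_trace.
suff /divzK e : (2 %| t + B * u)%Z by rewrite -[LHS]e mulrC.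
have e : (t + B * u) * (t + B * u - 2 * (B * u)) + 4 * (A * C * u ^+ 2)
    = t ^+ 2 - (B ^+ 2 - 4 * A * C) * u ^+ 2 by ring.
move: h; rewrite -{}e.
move: (t + B * u) => x; move: (B * u) => y; move: (A * C * u ^+ 2) => v h.
apply: contraT => hx; have [k kE] : exists k, x = 2 * k + 1.
  by exists (x %/ 2)%Z; lia.
move: h; rewrite kE.
have -> : (2 * k + 1) * (2 * k + 1 - 2 * y) + 4 * v
   = 2 * (2 * k * (k - y) + 2 * k - y + 2 * v) + 1 by ring.
lia.
Qed.

Lemma half_trace_eq (B t u z : int) : t + B * u = 2 * z -> half_trace B t u = z.
Proof. by rewrite /half_trace => ->; rewrite mulrC mulzK. Qed.

(** Up to the sign of B, the automorph of the form attached to (t, u), extended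
    to solutions with t^2 - D u^2 = -4, where it maps the form to its
    opposite. *)
Definition automat (f : form) (tu : int * int) : int * int * int * int :=
  let: (A, B, C) := f in let: (t, u) := tu in
  let z := half_trace B t u in (z, - (C * u), A * u, z - B * u).

Definition zmat (f : form) (tu : int * int) : int * int * int * int :=
  let: (A, B, C) := f in let: (t, u) := tu in
  let z := half_trace B t u in (z, z - C * u, z - A * u, (B - A - C) * u).

Lemma det_automat f t u : pell4 (disc f) t u ->
  4 * det2 (automat f (t, u)) = t ^+ 2 - disc f * u ^+ 2.
Proof.
case: f => [[A B] C] h; have e := half_traceE h.
have {}e : t = 2 * half_trace B t u - B * u by lia.
by rewrite [in RHS]e /=; ring.
Qed.

Lemma det_zmat f tu : det2 (zmat f tu) = - det2 (automat f tu).
Proof. by case: f tu => [[A B] C] [t u] /=; ring. Qed.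

Lemma det_automat_pm1 f t u : pell4 (disc f) t u ->
  det2 (automat f (t, u)) = 1 \/ det2 (automat f (t, u)) = -1.
Proof. by move=> h; have := det_automat h; case: h => _ _; lia. Qed.

(** With x = A u and y = - C u positive, G-reducedness says that the difference
    of the diagonal entries exceeds |x - y|, while their product is x y up to 1.
    Two numbers whose product is x y up to 1 and that are further apart than x
    and y must enclose x and y. *)
Lemma automat_shaped A B C t u : 0 < A -> C < 0 -> `|A + C| < B ->
  pell4 (disc (A, B, C)) t u -> cf_shaped (automat (A, B, C) (t, u)).
Proof.
move=> A0 C0 hB h; have := det_automat_pm1 h; have := half_traceE h.
case: h => t0 u0 _; rewrite /automat; move: (half_trace _ _ _) => z hz.
rewrite /det2; set x := A * u; set y := - (C * u); set w := z - B * u => hdet.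
have x0 : 0 < x by rewrite mulr_gt0.
have y0 : 0 < y by rewrite /y; nia.
have hxy : x - y < z - w /\ y - x < z - w.
  have -> : x - y = (A + C) * u by rewrite /x /y; ring.
  have -> : y - x = - (A + C) * u by rewrite /x /y; ring.
  have -> : z - w = B * u by rewrite /w; ring.
  by rewrite !ltr_pM2r //; lia.
have hzw : 0 < z + w by rewrite /w; lia.
move: (x) (y) (w) x0 y0 hxy hzw hdet => {x y w} x y w x0 y0 hxy hzw hdet.
clear -x0 y0 hxy hzw hdet.
have w0 : 0 <= w by nia.
have wy : w <= y by nia.
have wx : w <= x by nia.
have yz : y <= z by nia.
have xz : x <= z by nia.
by split.
Qed.

(** Here t is the difference between the antidiagonal sum b + c and the last
    entry d, so that t > 0 excludes nonpositive b or c: otherwise z d - b c would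
    exceed 1. If b or c were less than d, then b c would be too small instead. *)
Lemma zmat_shaped A B C t u : 0 < A -> 0 < C -> A + C < B ->
  pell4 (disc (A, B, C)) t u -> cf_shaped (zmat (A, B, C) (t, u)).
Proof.
move=> A0 C0 hB h; set m := zmat _ _.
have hd : det2 m = 1 \/ det2 m = -1.
  by rewrite det_zmat; have := det_automat_pm1 h; lia.
move: hd; have := half_traceE h.
case: h => t0 u0 _; rewrite /m /zmat; move: (half_trace _ _ _) => z hz.
rewrite /det2; set b := z - C * u; set c := z - A * u; set d := (B - A - C) * u => hdet.
have d0 : 0 < d by rewrite mulr_gt0 //; lia.
have bz : b < z by rewrite /b; nia.
have cz : c < z by rewrite /c; nia.
have htr : d < b + c.
  have -> : d = B * u - A * u - C * u by rewrite /d; ring.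
  by rewrite /b /c; lia.
move: (b) (c) (d) d0 bz cz htr hdet => {b c d} b c d d0 bz cz htr hdet.
clear -d0 bz cz htr hdet.
have b0 : 0 < b.
  rewrite ltNge; apply/negP => b0; have bc : b * c <= 0 by nia.
  have zd : z <= z * d by nia.
  by lia.
have c0 : 0 < c.
  rewrite ltNge; apply/negP => c0; have bc : b * c <= 0 by nia.
  have zd : z <= z * d by nia.
  by lia.
have db : d <= b by nia.
have dc : d <= c by nia.
by split; [split=> //; exact: ltW|split=> //; exact: ltW|].
Qed.

(** The inequality of G-reducedness, read back from the shape of the matrix. *)
Lemma cf_shaped_trace a b c d : cf_shaped (a, b, c, d) -> `|c - b| < a - d.
Proof.
move=> [[b0 c0 d0] [h1 h2 h3 h4] h5].
have [hn|hn] : (a = c /\ b = d) \/ ((a = b /\ c = d) \/ `|c - b| < a - d) by lia.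
  by move: h5; rewrite hn.1 hn.2 [c * d]mulrC subrr; lia.
case: hn => // hn; by move: h5; rewrite hn.1 hn.2 subrr; lia.
Qed.

Lemma half_trace_rat (A B C t u : int) : pell4 (disc (A, B, C)) t u ->
  (t + B * u)%:~R / 2 = (half_trace B t u)%:~R :> rat.
Proof.
move=> h; rewrite (half_traceE h) intrM mulrAC divff ?mul1r //.
Qed.

Lemma odd_size_automat f t u q : pell4 (disc f) t u ->
  cfmat q = automat f (t, u) ->
  odd (size q) = (t ^+ 2 - disc f * u ^+ 2 == -4).
Proof.
move=> h e; rewrite odd_size_cfmat e; have := det_automat h.
by case: eqP; case: eqP; lia.
Qed.

Lemma odd_size_zmat f t u q : pell4 (disc f) t u ->
  cfmat q = zmat f (t, u) ->
  odd (size q) = (t ^+ 2 - disc f * u ^+ 2 != -4).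
Proof.
move=> h e; rewrite odd_size_cfmat e det_zmat.
have := det_automat_pm1 h; have := det_automat h.
by case: eqP; case: eqP; lia.
Qed.

Lemma gamma_eq f q : pell4 (disc f) (fund_sol (disc f)).1 (fund_sol (disc f)).2 ->
  S1 q -> cfmat q = automat f (fund_sol (disc f)) -> gamma f = q.
Proof.
case: f => [[A B] C]; rewrite /gamma; case: (fund_sol _) => t u /= h hq e.
apply: cfexp_eq => //; last exact: (odd_size_automat (f := (A, B, C)) h e).
by have := cfval_cfmat hq; rewrite e /= (half_trace_rat h).
Qed.

Lemma beta_eq f q : pell4 (disc f) (fund_sol (disc f)).1 (fund_sol (disc f)).2 ->
  S1 q -> cfmat q = zmat f (fund_sol (disc f)) -> beta f = q.
Proof.
case: f => [[A B] C]; rewrite /beta; case: (fund_sol _) => t u /= h hq e.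
apply: cfexp_eq => //; last exact: (odd_size_zmat (f := (A, B, C)) h e).
by have := cfval_cfmat hq; rewrite e /= (half_trace_rat h) intrB.
Qed.

(** * Reduced forms and the map mu *)

Lemma indefinite_pell f : indefinite f ->
  pell4 (disc f) (fund_sol (disc f)).1 (fund_sol (disc f)).2.
Proof. by case=> D0 hD; case: (fund_sol_fundamental D0 hD). Qed.

Lemma GposP A B C : Gpos (A, B, C) <->
  indefinite (A, B, C) /\ [/\ 0 < A, C < 0 & `|A + C| < B].
Proof.
split=> [[[hi hAC hB] /= A0]|[hi [A0 C0 hB]]].
  by split=> //; split=> //; rewrite -(pmulr_rlt0 _ A0).
by split=> //; split=> //; rewrite pmulr_rlt0.
Qed.

Lemma gammaP f : Gpos f ->
  S1 (gamma f) /\ cfmat (gamma f) = automat f (fund_sol (disc f)).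
Proof.
case: f => [[A B] C] /GposP [hi [A0 C0 hB]]; have h := indefinite_pell hi.
have [q hq e] : exists2 q, S1 q & cfmat q = automat (A, B, C) (fund_sol (disc (A, B, C))).
  apply: cf_shaped_cfmat; move: h; case: (fund_sol _) => t u.
  exact: automat_shaped.
by rewrite (gamma_eq h hq e).
Qed.

Lemma S2_cfmat q : S1 q -> S2 q <-> 0 < (cfmat q).2.
Proof.
move=> hq; case: q hq => [/S1_nil//|x [|y s]] hq; first by split=> [[]|].
split=> // _; have [_ [//|/cfmat_shaped]] := (S1_cons _ _).1 hq.
by rewrite /=; case: (cfmat s) => [[[a b] c] d] [[]].
Qed.

Lemma betaP f : Zforms f ->
  S2 (beta f) /\ cfmat (beta f) = zmat f (fund_sol (disc f)).
Proof.
case: f => [[A B] C] [hi [A0 B0 C0] hB]; have h := indefinite_pell hi.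
have [q hq e] : exists2 q, S1 q & cfmat q = zmat (A, B, C) (fund_sol (disc (A, B, C))).
  apply: cf_shaped_cfmat; move: h; case: (fund_sol _) => t u.
  exact: zmat_shaped.
rewrite (beta_eq h hq e); split=> //; apply/(S2_cfmat hq); rewrite e.
move: h; case: (fund_sol _) => t u [/= _ u0 _].
by rewrite mulr_gt0 //; lia.
Qed.

Lemma rhoK : involutive rho.
Proof. by case=> [[A B] C]; rewrite /rho !opprK. Qed.

Lemma disc_rho f : disc (rho f) = disc f.
Proof. by case: f => [[A B] C] /=; ring. Qed.

Lemma disc_mu f : disc (mu f) = disc f.
Proof. by case: f => [[A B] C] /=; case: ifP => _ /=; ring. Qed.

Lemma eq_indefinite f g : disc f = disc g -> indefinite f -> indefinite g.
Proof. by rewrite /indefinite => ->. Qed.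

Lemma Gneg_rho f : Gneg (rho f) <-> Gpos f.
Proof.
case: f => [[A B] C]; rewrite GposP; split=> [[[hi hAC hB] /= A0]|[hi [A0 C0 hB]]].
  split; first by apply: eq_indefinite hi; exact: (disc_rho (A, B, C)).
  by split; [lia|nia|lia].
split; last by rewrite /=; lia.
split; [|nia|lia]; apply: eq_indefinite hi; exact/esym/(disc_rho (A, B, C)).
Qed.

Lemma Gpos_rho f : Gpos (rho f) <-> Gneg f.
Proof. by rewrite -Gneg_rho rhoK. Qed.

Lemma GnegP A B C : Gneg (A, B, C) <->
  indefinite (A, B, C) /\ [/\ A < 0, 0 < C & `|A + C| < B].
Proof.
have i f g : disc f = disc g -> indefinite f <-> indefinite g.
  by rewrite /indefinite => ->.
rewrite -Gpos_rho /rho GposP (i (- A, B, - C) (A, B, C)); last exact: (disc_rho (A, B, C)).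
by split=> -[hi [h1 h2 h3]]; split=> //; split; lia.
Qed.

Lemma mu_pos f : Gpos f -> Zforms (mu f).
Proof.
case: f => [[A B] C] /GposP [hi [A0 C0 hB]].
have := eq_indefinite (esym (disc_mu (A, B, C))) hi.
rewrite /mu A0 => hi'; split=> //; [split|]; lia.
Qed.

Lemma mu_neg f : Gneg f -> Zforms (mu f).
Proof.
case: f => [[A B] C] /GnegP [hi [A0 C0 hB]].
have := eq_indefinite (esym (disc_mu (A, B, C))) hi.
rewrite /mu ltNge ltW //= => hi'; split=> //; [split|]; lia.
Qed.

Lemma cfmat_rcons s x : cfmat (rcons s x) =
  let: (a, b, c, d) := cfmat s in (a * x%:Z + b, a, c * x%:Z + d, c).
Proof.
elim: s => [|y s /= ->] /=; first by congr (_, _, _, _); ring.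
by case: (cfmat s) => [[[a b] c] d] /=; congr (_, _, _, _); ring.
Qed.

Lemma S1_etapos q : S1 q -> S2 (etapos q).
Proof.
move=> hq; split; last by case: q hq => [/S1_nil|].
by apply/S1_cons; split=> //; right.
Qed.

Lemma S1_etaneg q : S1 q -> S2 (etaneg q).
Proof.
case=> q0 hq; rewrite /etaneg; split; last by rewrite size_rcons; case: q q0 {hq}.
by split; [case: (q)|rewrite all_rcons].
Qed.

(** Replacing the form by its image under mu adds A u to z, which is adding the
    second row of the matrix to the first: a left factor with rows (1, 1) and
    (1, 0), that is, a leading quotient 1. *)
Lemma beta_mu_pos f : Gpos f -> beta (mu f) = etapos (gamma f).
Proof.
move=> hf; have [hq e] := gammaP hf.
have hZ := mu_pos hf.
apply: beta_eq; rewrite ?disc_mu.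
- by apply: indefinite_pell; case: (f) hf => [[A B] C] /GposP[].
- by case: (S1_etapos hq).
move: e; rewrite /etapos /= => ->.
have := hf; case: f {hf hq hZ} => [[A B] C] /GposP [hi [A0 C0 hB]].
have := indefinite_pell hi; rewrite /mu A0; case: (fund_sol _) => t u /= h.
have hz : half_trace (2 * A + B) t u = half_trace B t u + A * u.
  by apply: half_trace_eq; have := half_traceE h; rewrite !mulrDl -!mulrA; lia.
rewrite hz; congr (_, _, _, _); ring.
Qed.

(** Here mu adds C u to z, which is an operation on the columns of the matrix of
    rho f: a right factor, that is, a final quotient 1. *)
Lemma beta_mu_neg f : Gneg f -> beta (mu f) = etaneg (gamma (rho f)).
Proof.
move=> hf; have [hq e] := gammaP ((Gpos_rho f).2 hf).
have hZ := mu_neg hf.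
apply: beta_eq; rewrite ?disc_mu.
- by apply: indefinite_pell; case: (f) hf => [[A B] C] /GnegP[].
- by case: (S1_etaneg hq).
move: e; rewrite /etaneg cfmat_rcons => ->; rewrite disc_rho.
have := hf; case: f {hf hq hZ} => [[A B] C] /GnegP [hi [A0 C0 hB]].
have := indefinite_pell hi; rewrite /mu ltNge ltW //=; case: (fund_sol _) => t u /= h.
have hz : half_trace (B + 2 * C) t u = half_trace B t u + C * u.
  by apply: half_trace_eq; have := half_traceE h; rewrite !mulrDl -!mulrA; lia.
rewrite hz; congr (_, _, _, _); ring.
Qed.

Lemma mu_inj_pos : set_inj Gpos mu.
Proof.
move=> [[A B] C] [[A' B'] C'] /set_mem /GposP [_ [A0 _ _]] /set_mem /GposP [_ [A'0 _ _]].
by rewrite /mu A0 A'0 => -[-> h1 h2]; congr (_, _, _); lia.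
Qed.

Lemma mu_inj_neg : set_inj Gneg mu.
Proof.
move=> [[A B] C] [[A' B'] C'] /set_mem /GnegP [_ [A0 _ _]] /set_mem /GnegP [_ [A'0 _ _]].
by rewrite /mu !ltNge !ltW //= => -[h1 h2 h3]; congr (_, _, _); lia.
Qed.

Lemma automat_Gpos A B C t u : 0 < u -> indefinite (A, B, C) ->
  cf_shaped (automat (A, B, C) (t, u)) -> Gpos (A, B, C).
Proof.
move=> u0 hi hs; have /cf_shaped_trace := hs; case: hs => [[b0 c0 _] _ _] htr.
apply/GposP; split=> //; split; [by rewrite -(pmulr_lgt0 _ u0)|by nia|].
rewrite -(ltr_pM2r u0) -[u in X in X < _]gtr0_norm // -normrM.
by rewrite mulrDl; move: htr; lia.
Qed.

(** The preimage g is found by inverting mu; the matrix of g is the matrix of f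
    with its leading factor cancelled, hence that of q, and its shape makes g
    reduced. *)
Lemma mu_onto_pos f q : Zforms f -> S1 q -> beta f = etapos q ->
  exists2 g, Gpos g & mu g = f.
Proof.
case: f => [[A B] C] hf hq hb; have [_] := betaP hf; rewrite hb /etapos.
have := cfmat_shaped hq; case: hf => hi [A0 B0 C0] hB.
pose g := (A, B - 2 * A, A - B + C).
have Dg : disc g = disc (A, B, C) by rewrite /=; ring.
have hig : indefinite g := eq_indefinite (esym Dg) hi.
have := indefinite_pell hi; case: (fund_sol _) => t u h hs e.
exists g; last by rewrite /g /mu A0; congr (_, _, _); ring.
have u0 : 0 < u by case: h.
apply: (automat_Gpos (t := t) u0 hig); suff <- : cfmat q = automat g (t, u) by [].
have hz : half_trace (B - 2 * A) t u = half_trace B t u - A * u.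
  by apply: half_trace_eq; have := half_traceE h; rewrite /= mulrBl -!mulrA; lia.
move: e; rewrite /= hz; case: (cfmat q) {hs} => [[[a b] c] d] [e1 e2 e3 e4].
by congr (_, _, _, _); lia.
Qed.

Lemma mu_onto_neg f q : Zforms f -> S1 q -> beta f = etaneg q ->
  exists2 g, Gneg g & mu g = f.
Proof.
case: f => [[A B] C] hf hq hb; have [_] := betaP hf; rewrite hb /etaneg cfmat_rcons.
have := cfmat_shaped hq; case: hf => hi [A0 B0 C0] hB.
pose g := (B - A - C, B - 2 * C, - C).
have Dg : disc g = disc (A, B, C) by rewrite /=; ring.
have hig : indefinite g := eq_indefinite (esym Dg) hi.
have := indefinite_pell hi; case: (fund_sol _) => t u h hs e.
exists (rho g); last first.
  by rewrite /g /rho /mu ifF ?opprK; [congr (_, _, _); ring|lia].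
apply/Gneg_rho.
have u0 : 0 < u by case: h.
apply: (automat_Gpos (t := t) u0 hig); suff <- : cfmat q = automat g (t, u) by [].
have hz : half_trace (B - 2 * C) t u = half_trace B t u - C * u.
  by apply: half_trace_eq; have := half_traceE h; rewrite /= mulrBl -!mulrA; lia.
move: e; rewrite /= hz; case: (cfmat q) {hs} => [[[a b] c] d] [e1 e2 e3 e4].
by congr (_, _, _, _); lia.
Qed.

(** * The sections xi and tau *)

Lemma cfmat_continuant q : (cfmat q).1.1.1 = (continuant q)%:Z.
Proof.
suff: (cfmat q).1.1.1 = (continuant q)%:Z /\
   (cfmat q).1.2 = if q is x :: s then (continuant s)%:Z else 0 by case.
elim: q => [//|x [|y s] IH]; first by rewrite /=; split; lia.
rewrite [cfmat _]/= -/(cfmat (y :: s)); case: (cfmat (y :: s)) IH => [[[a b] c] d].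
by move=> [/= -> ->]; split=> //; rewrite PoszD PoszM.
Qed.

Lemma cfmat_cont q : q <> [::] ->
  cfmat q = (cont q 1 (size q), cont q 1 (size q).-1,
             cont q 2 (size q), cont q 2 (size q).-1).
Proof.
case: q => // x s _; case/lastP: s => [|s y].
  by rewrite /= /cont /= mulr1 mulr0 addr0.
have := cfmat_continuant s; have := cfmat_continuant (rcons s y).
have := cfmat_continuant (x :: s); have := cfmat_continuant (x :: rcons s y).
rewrite /cont [size _]/= size_rcons /= ?take0 ?drop0.
rewrite [take (size s).+1 _]take_oversize ?size_rcons //.
rewrite -[in take _ _]cats1 take_size_cat //.
by rewrite cfmat_rcons; case: (cfmat s) => [[[a b] c] d] /= <- <- <- <-.
Qed.

Lemma xiE q : S1 q ->
  xi q = let: (a, b, c, d) := cfmat q in (c, a - d, - b).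
Proof. by case=> q0 _; rewrite (cfmat_cont q0). Qed.

(** For t > 0, no square differs from t^2 by 4, except 0 = 2^2 - 4; the case
    t = 1, e = -1 would give a negative discriminant. *)
Lemma near_square_indefinite f (t e : int) : 0 < t -> disc f = t ^+ 2 + 4 * e ->
  e = 1 \/ (e = -1 /\ 3 <= t) -> indefinite f.
Proof.
move=> t0 hD he; split; first by rewrite hD; case: he => [->|[-> h]]; nia.
move=> [k hk].
have : `|k| ^+ 2 = t ^+ 2 + 4 * e by rewrite real_normK ?num_real // -hk.
have : 0 <= `|k| by [].
move: (`|k|) => {hk} j j0 hj.
case: he => [e1|[e1 t3]]; subst e.
  have [h|[h|h]] : j <= t \/ j = t + 1 \/ t + 2 <= j by lia.
  - by nia.
  - by move: hj; rewrite h; nia.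
  - by nia.
have [h|[h|h]] : t <= j \/ j = t - 1 \/ j <= t - 2 by lia.
- by nia.
- by move: hj; rewrite h; nia.
- by nia.
Qed.

Lemma disc_xi q : S1 q -> let: (a, b, c, d) := cfmat q in
  disc (xi q) = (a + d) ^+ 2 - 4 * (-1) ^+ size q.
Proof.
move=> hq; rewrite (xiE hq) -det_cfmat; case: (cfmat q) => [[[a b] c] d] /=; ring.
Qed.

Lemma sgn_cases n : (-1) ^+ n = 1 :> int \/ (-1) ^+ n = -1 :> int.
Proof. by rewrite -signr_odd; case: odd; [right|left]. Qed.

Lemma xi_pos q : S1 q -> Gpos (xi q).
Proof.
move=> hq; have := disc_xi hq; have := det_cfmat q; have := cfmat_shaped hq.
have htr a b c d := @cf_shaped_trace a b c d.
rewrite (xiE hq); case: (cfmat q) => [[[a b] c] d] hs hd hD.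
have {}htr := htr _ _ _ _ hs; case: hs => [[b0 c0 d0] [h1 h2 h3 h4] h5].
apply/GposP; split; last by split; lia.
have hD' : disc (c, a - d, - b) = (a + d) ^+ 2 + 4 * - (-1) ^+ size q by rewrite hD; ring.
apply: near_square_indefinite hD' _; first by lia.
move: hd; rewrite /det2 => <-; case: h5 => e; rewrite e; [right|by left].
split=> //; have [d0'|d1] : d = 0 \/ 1 <= d by lia.
  by move: e; rewrite d0'; nia.
have [d2|d2] : 2 <= d \/ d = 1 by lia.
  by lia.
have [a1|a2] : a = 1 \/ 2 <= a by lia.
  by move: e; rewrite a1 d2; nia.
by lia.
Qed.

(** The solution (a + d, 1) is fundamental except when the discriminant is 5 and
    a + d = 3, which leaves only the matrix with rows (2, 1) and (1, 1), that
    of [gamma_gap]. *)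
Lemma gamma_xi q : S1 q -> q <> gamma_gap -> gamma (xi q) = q.
Proof.
move=> hq hgap; have := disc_xi hq; have := det_cfmat q; have := cfmat_shaped hq.
case E : (cfmat q) => [[[a b] c] d] hs hd hD.
have hf : fund_sol (disc (xi q)) = (a + d, 1).
  case: hs => [[b0 c0 d0] [h1 h2 h3 h4] h5].
  apply: fund_sol_unit.
    split; [lia|lia|rewrite hD expr1n mulr1].
    by case: (sgn_cases (size q)) => ->; lia.
  rewrite hD => D5; case: (sgn_cases (size q)) hd => es; rewrite es in D5 *; last by nia.
  rewrite /det2 => hd; have ad : a + d = 3 by nia.
  case: hgap; apply: cfmat_inj => //; rewrite E.
  have [d1 a2] : d = 1 /\ a = 2 by nia.
  by subst a d; congr (_, _, _, _); nia.
apply: gamma_eq => //.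
  by apply: indefinite_pell; case: (xi q) (xi_pos hq) => [[? ?] ?] /GposP [].
rewrite hf E (xiE hq) E /automat.
rewrite (_ : half_trace _ _ _ = a); last by apply: half_trace_eq; ring.
by congr (_, _, _, _); ring.
Qed.

(** A discriminant k^2 + 4 or k^2 - 4 has the solution (|k|, 1), whether or not it
    is the fundamental one, and its matrix determines the sequence. *)
Lemma xi_onto f k : Gpos f -> disc f = k ^+ 2 + 4 \/ disc f = k ^+ 2 - 4 ->
  exists2 q, S1 q & xi q = f.
Proof.
case: f => [[A B] C] /GposP [hi [A0 C0 hB]] hk.
have k0 : k != 0.
  apply/eqP => k0; case: hi.
  by case: hk => ->; rewrite k0 expr0n //= add0r => _ []; exists 2.
have h : pell4 (disc (A, B, C)) `|k| 1.
  split=> //; first by rewrite normr_gt0.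
  by rewrite expr1n mulr1 real_normK ?num_real //; lia.
have [q hq e] := cf_shaped_cfmat (automat_shaped A0 C0 hB h).
exists q => //; rewrite (xiE hq) e /automat; congr (_, _, _); ring.
Qed.

Lemma decr_head x s : decr 0 (x :: s) = x.-1 :: s.
Proof. by []. Qed.

Lemma decr_last s y : decr (size s) (rcons s y) = rcons s y.-1.
Proof.
rewrite /decr nth_rcons ltnn eqxx; elim: s => [|x s IH] //=.
by rewrite IH.
Qed.

Lemma tauE q : S2 q -> tau q =
  let: (a, b, c, d) := cfmat q in (a - c, 2 * a - b - c + d, a - b).
Proof.
case: q => [|x s] [hq] //; case/lastP: s hq => // s y hq _.
have [x0 y0] : (0 < x)%N /\ (0 < y)%N.
  by case: hq => _ /=; rewrite all_rcons => /and3P[].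
rewrite /tau -!cfmat_continuant.
have hs : (size (x :: rcons s y)).-1 = size (x :: s) by rewrite /= size_rcons.
rewrite hs -rcons_cons decr_last !rcons_cons !decr_head /= !cfmat_rcons.
case: (cfmat s) => [[[a b] c] d] /=.
have -> : x.-1%:Z = x%:Z - 1 by lia.
have -> : y.-1%:Z = y%:Z - 1 by lia.
congr (_, _, _); ring.
Qed.

(** The discriminant has the solution (t, 1) with t = b + c - d. When the
    determinant is -1, discriminant 5 would mean t = 3, which leaves only the
    matrix of [beta_gap]. *)
Lemma tau_spec q a b c d : S2 q -> cfmat q = (a, b, c, d) ->
  [/\ c < a /\ b < a, 0 < d,
      disc (tau q) = (b + c - d) ^+ 2 + 4 * (a * d - b * c)
    & a * d - b * c = 1 \/ [/\ a * d - b * c = -1, 3 <= b + c - d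
        & b + c - d = 3 -> (a, b, c, d) = (3, 2, 2, 1)]].
Proof.
move=> hq2; have hq := hq2.1; have := (S2_cfmat hq).1 hq2.
have := cfmat_shaped hq; rewrite (tauE hq2) => + + e; rewrite e /=.
move=> [[b0 c0 _] [h1 h2 h3 h4] h5] d0.
split=> //.
- have gap (e' : int) : d <= e' -> e' <= a -> a * (d - e') <> 1 /\ a * (d - e') <> -1.
    move=> he he'; have [->|h] : d = e' \/ d + 1 <= e' by lia.
      by rewrite subrr mulr0.
    have : a * (d - e') <= - a by nia.
    lia.
  split; rewrite lt_neqAle ?h3 ?h4 andbT; apply/eqP => ea.
    by have [] := gap b h1 h3; move: h5; rewrite ea mulrBr [b * _]mulrC; lia.
  by have [] := gap c h2 h4; move: h5; rewrite ea mulrBr; lia.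
- by ring.
- case: h5 => [->|hd]; [by left|right].
  have [t4|t3] := leP 4 (b + c - d); first by split=> //; lia.
  have [b3 c3 d3] : [/\ b <= 3, c <= 3 & d <= 3] by split; lia.
  have hb : b = 1 \/ b = 2 \/ b = 3 by lia.
  have hc : c = 1 \/ c = 2 \/ c = 3 by lia.
  have hdd : d = 1 \/ d = 2 \/ d = 3 by lia.
  clear e hq hq2.
  have sol : b = 2 /\ c = 2 /\ d = 1 /\ a = 3.
    by case: hb => [|[|]] hb; case: hc => [|[|]] hc; case: hdd => [|[|]] hdd;
      subst b c d; lia.
  by case: sol => -> [-> [-> ->]].
Qed.

Lemma tau_Z q : S2 q -> Zforms (tau q).
Proof.
move=> hq2; have hq := hq2.1; have := cfmat_shaped hq; have := tauE hq2.
case E : (cfmat q) => [[[a b] c] d] et [[b0 c0 d0] [h1 h2 h3 h4] _].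
have [[ca ba] d1 hD hdet] := tau_spec hq2 E.
have hi : indefinite (tau q).
  apply: near_square_indefinite hD _; first by lia.
  by case: hdet => [->|[-> ? _]]; [left|right].
by rewrite et in hi *; split=> //; [split; lia|lia].
Qed.

Lemma beta_tau q : S2 q -> q <> beta_gap -> beta (tau q) = q.
Proof.
move=> hq2 hgap; have hq := hq2.1; have := cfmat_shaped hq; have := tauE hq2.
case E : (cfmat q) => [[[a b] c] d] et [[b0 c0 d0] [h1 h2 h3 h4] _].
have [[ca ba] d1 hD hdet] := tau_spec hq2 E.
have hf : fund_sol (disc (tau q)) = (b + c - d, 1).
  apply: fund_sol_unit.
    split; [lia|lia|rewrite hD expr1n mulr1].
    by case: hdet => [->|[-> _ _]]; lia.
  rewrite hD; case: hdet => [->|[-> t3 h9]] D5; first by nia.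
  by case: hgap; apply: cfmat_inj => //; rewrite E h9 //; nia.
apply: beta_eq => //.
  by apply: indefinite_pell; case: (tau q) (tau_Z hq2) => [[? ?] ?] [].
rewrite hf E et /zmat.
rewrite (_ : half_trace _ _ _ = a); last by apply: half_trace_eq; ring.
by congr (_, _, _, _); ring.
Qed.

(** * Binary strings *)

Fixpoint sb_inv (b : seq bool) : seq nat :=
  match b with
  | [::] => [:: 1%N]
  | true :: b' => 1%N :: sb_inv b'
  | false :: b' => if sb_inv b' is x :: s then x.+1 :: s else [::]
  end.

Lemma sb_inv_S1 b : S1 (sb_inv b).
Proof.
elim: b => [|[] b IH] /=; first by apply/S1_cons; split=> //; left.
  by apply/S1_cons; split=> //; right.
by case: (sb_inv b) IH => [/S1_nil//|x s] /S1_cons [x0 hs]; apply/S1_cons.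
Qed.

Lemma sb_consS x s : (0 < x)%N -> sb (x.+1 :: s) = false :: sb (x :: s).
Proof. by case: x => // x _; case: s. Qed.

Lemma sb_cons1 s : S1 s -> sb (1%N :: s) = true :: sb s.
Proof. by case: s => [/S1_nil|]. Qed.

Lemma sb_invK b : sb (sb_inv b) = b.
Proof.
elim: b => [//|[] b IH]; rewrite [sb_inv _]/=.
  by rewrite sb_cons1 ?IH //; exact: sb_inv_S1.
have := sb_inv_S1 b; move: IH; case: (sb_inv b) => [_ /S1_nil//|x s] <- /S1_cons [x0 _].
by rewrite sb_consS.
Qed.

Lemma sbK s : S1 s -> sb_inv (sb s) = s.
Proof.
elim: s => [/S1_nil//|x s IH] /S1_cons [x0 hs].
elim: x x0 => // -[_ _|x /(_ isT) IHx _]; last by rewrite sb_consS //= IHx.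
by case: hs => [->//|hs]; rewrite sb_cons1 //= IH.
Qed.

Lemma has_sb s : S1 s -> has id (sb s) = (2 <= size s)%N.
Proof.
case: s => [/S1_nil//|x [_|y s _]] /=; first by rewrite has_nseq andbF.
by rewrite has_cat /= orbT.
Qed.

Lemma sb_bij : set_bij S2 B1 sb.
Proof.
split.
- by move=> q [hq hs]; rewrite /B1 /= has_sb.
- by move=> q q' /set_mem [hq _] /set_mem [hq' _] e; rewrite -(sbK hq) e sbK.
- move=> b hb; exists (sb_inv b); last exact: sb_invK.
  by split; [|rewrite -has_sb ?sb_invK //]; exact: sb_inv_S1.
Qed.

(** * The theorem *)

Theorem theorem4p2 :
  ((forall f, Gpos f -> beta (mu f) = etapos (gamma f)) /\
   (forall f, Gneg f -> beta (mu f) = etaneg (gamma (rho f)))) /\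
  ([/\ set_fun Gpos Zforms mu /\ set_inj Gpos mu,
       set_fun Gneg Zforms mu /\ set_inj Gneg mu,
       set_fun S1 S2 etapos /\ set_inj S1 etapos
     & set_fun S1 S2 etaneg /\ set_inj S1 etaneg] /\
   set_bij S2 B1 sb /\
   [/\ set_fun Gpos S1 gamma /\ set_surj Gpos (S1 `\ gamma_gap) gamma,
       set_fun Gneg S1 (gamma \o rho) /\
         set_surj Gneg (S1 `\ gamma_gap) (gamma \o rho)
     & set_fun Zforms S2 beta /\ set_surj Zforms (S2 `\ beta_gap) beta]) /\
  (mu @` Gpos = Zforms `&` beta @^-1` (etapos @` S1) /\
   mu @` Gneg = Zforms `&` beta @^-1` (etaneg @` S1)) /\
  (set_fun S2 Zforms tau /\
   (forall q, S2 q -> q <> beta_gap -> beta (tau q) = q)) /\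
  [/\ set_fun S1 Gpos xi,
      (forall q, S1 q -> q <> gamma_gap -> gamma (xi q) = q),
      xi @` S1 =
        [set f | Gpos f /\
           exists k : int, disc f = k ^+ 2 + 4 \/ disc f = k ^+ 2 - 4]
    & forall q, S1 q ->
        disc (xi q) = (cont q 1 (size q) + cont q 2 (size q).-1) ^+ 2
                      + (-1) ^+ (size q).+1 * 4].
Proof.
have gamma_S1 f : Gpos f -> S1 (gamma f) by case/gammaP.
split; first by split; [exact: beta_mu_pos|exact: beta_mu_neg].
split; last split; last split.
- split; [split|split; [exact: sb_bij|split]]; split.
  + exact: mu_pos.
  + exact: mu_inj_pos.
  + exact: mu_neg.
  + exact: mu_inj_neg.
  + exact: S1_etapos.
  + by move=> q q' _ _ [].
  + exact: S1_etaneg.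
  + by move=> q q' _ _; rewrite /etaneg => /rcons_inj[].
  + exact: gamma_S1.
  + by move=> q [hq hgap]; exists (xi q); [exact: xi_pos|exact: gamma_xi].
  + by move=> f /Gpos_rho; exact: gamma_S1.
  + move=> q [hq hgap]; exists (rho (xi q)); first exact/Gneg_rho/xi_pos.
    by rewrite -[LHS]/(gamma (rho (rho (xi q)))) rhoK gamma_xi.
  + by move=> f /betaP[].
  + by move=> q [hq hgap]; exists (tau q); [exact: tau_Z|exact: beta_tau].
- split; apply/seteqP; split=> f.
  + move=> [g hg <-]; split; first exact: mu_pos.
    by exists (gamma g); [exact: gamma_S1|rewrite beta_mu_pos].
  + by move=> [hf [q hq /esym e]]; have [g] := mu_onto_pos hf hq e; exists g.
  + move=> [g hg <-]; split; first exact: mu_neg.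
    by exists (gamma (rho g)); [exact/gamma_S1/Gpos_rho|rewrite beta_mu_neg].
  + by move=> [hf [q hq /esym e]]; have [g] := mu_onto_neg hf hq e; exists g.
- by split; [exact: tau_Z|exact: beta_tau].
have disc_cont q : S1 q -> disc (xi q) =
    (cont q 1 (size q) + cont q 2 (size q).-1) ^+ 2 + (-1) ^+ (size q).+1 * 4.
  move=> hq; have := disc_xi hq; rewrite (cfmat_cont hq.1) => ->.
  by rewrite [(-1) ^+ _.+1]exprS; ring.
split=> //; [exact: xi_pos|exact: gamma_xi|].
apply/seteqP; split=> f.
  move=> [q hq <-]; split; first exact: xi_pos.
  exists (cont q 1 (size q) + cont q 2 (size q).-1); rewrite disc_cont //.
  by case: (sgn_cases (size q).+1) => ->; [left|right]; ring.
by move=> [hf [k hk]]; have [q] := xi_onto hf hk; exists q.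
Qed.
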